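(* Let $\Sigma\subset\mathbb{R}^3$ be a compact, connected RT-surface. Then $\Sigma$ is a sphere with center at the origin.
   Context: For an oriented surface $\Sigma\subset\mathbb{R}^3$ with unit normal (Gauss map) $N$, the support function is $\Psi(p)=\langle p,N(p)\rangle$ and the quadratic distance function is $\Lambda(p)=\langle p,p\rangle$. For a local parameterization $X$ the Weingarten matrix $W=(W_{ij})$ is defined by $N_{,i}=\sum_{j}W_{ij}X_{,j}$ (subscripts ${}_{,i}$ denote partial derivatives); the Gaussian curvature is $K=\det W$ and the mean curvature is $H=-\tfrac12\operatorname{tr}W$. A surface $\Sigma$ with $K\neq 0$ is a Ribaucour-type surface (RT-surface) if for each $p\in\Sigma$ the sphere with center $p+\left(\frac{H(p)}{K(p)}+\frac{\Psi(p)}{2}\right)N(p)$ and (signed) radius $\frac{H(p)}{K(p)}+\frac{\Psi(p)}{2}$ passes through the origin; equivalently, $2\Psi H+(\Lambda+\Psi^2)K=0$ on $\Sigma$. *)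

(* Defs.v *)
From mathcomp Require Import all_boot all_order all_algebra.
From mathcomp Require Import all_classical all_reals all_analysis.

Set Implicit Arguments.
Unset Strict Implicit.
Unset Printing Implicit Defensive.

Import Order.TTheory GRing.Theory Num.Theory.
Import numFieldNormedType.Exports.

Local Open Scope classical_set_scope.
Local Open Scope ring_scope.

Section EuclideanSpace.
Context {R : realType}.

(* The library norm on 'rV[R]_n is the sup norm; it induces the usual topology
   and differentials, but Euclidean lengths have to go through [dot]. *)
Definition dot {n : nat} (u v : 'rV[R]_n) : R := \sum_(i < n) u ord0 i * v ord0 i.

Definition sphere (c : 'rV[R]_3) (r : R) : set 'rV[R]_3 :=
  [set q | dot (q - c) (q - c) = r ^+ 2].

Definition partial {n : nat} (i : 'I_2) (f : 'rV[R]_2 -> 'rV[R]_n)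
  : 'rV[R]_2 -> 'rV[R]_n := fun u => 'D_(delta_mx ord0 i) f u.

Fixpoint Ck_on {n : nat} (k : nat) (U : set 'rV[R]_2) (f : 'rV[R]_2 -> 'rV[R]_n)
  : Prop :=
  match k with
  | 0 => forall u, U u -> {for u, continuous f}
  | k'.+1 => (forall u, U u -> differentiable f u) /\
             (forall i, Ck_on k' U (partial i f))
  end.

Definition smooth_on {n : nat} (U : set 'rV[R]_2) (f : 'rV[R]_2 -> 'rV[R]_n) : Prop :=
  forall k, Ck_on k U f.

End EuclideanSpace.

Section Surfaces.
Context {R : realType}.
Implicit Types (S : set 'rV[R]_3) (N : 'rV[R]_3 -> 'rV[R]_3).
Implicit Types (U : set 'rV[R]_2) (X : 'rV[R]_2 -> 'rV[R]_3).

(* A regular parameterization of a relatively open piece of S: X is a smooth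
   immersion on U and a homeomorphism from U onto X @` U, with inverse Y. *)
Definition local_parameterization S U X : Prop :=
  [/\ open U,
      smooth_on U X,
      (forall u, U u -> injective ('d X u)),
      (exists2 V : set 'rV[R]_3, open V & X @` U = S `&` V) &
      (exists Y : 'rV[R]_3 -> 'rV[R]_2,
         (forall u, U u -> Y (X u) = u) /\ {within X @` U, continuous Y})].

(* A smooth embedded surface without boundary. *)
Definition regular_surface S : Prop :=
  S !=set0 /\
  forall p, S p -> exists U X, local_parameterization S U X /\ (X @` U) p.

(* N is a smooth unit normal field (Gauss map) on S; its values outside S are
   irrelevant. *)
Definition gauss_map S N : Prop :=
  forall U X, local_parameterization S U X ->
    smooth_on U (N \o X) /\
    forall u, U u ->
      dot (N (X u)) (N (X u)) = 1 /\
      forall i, dot (N (X u)) (partial i X u) = 0.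

Definition support_function N (p : 'rV[R]_3) : R := dot p (N p).

(* When X is a local parameterization and N the Gauss map, the matrix
   satisfying these equations exists and is unique. *)
Definition weingarten N X (u : 'rV[R]_2) : 'M[R]_2 :=
  get [set W : 'M[R]_2 | forall i : 'I_2,
         partial i (N \o X) u = \sum_(j < 2) W i j *: partial j X u].

Definition gauss_curvature N X (u : 'rV[R]_2) : R := \det (weingarten N X u).

Definition mean_curvature N X (u : 'rV[R]_2) : R := - (\tr (weingarten N X u) / 2).

(* The curvatures at p = X u do not depend on the parameterization X. *)
Definition rt_surface S N : Prop :=
  [/\ regular_surface S,
      gauss_map S N &
      forall U X, local_parameterization S U X -> forall u, U u ->
        let p := X u in
        let K := gauss_curvature N X u in
        let H := mean_curvature N X u in
        let r := H / K + support_function N p / 2 in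
        K != 0 /\ sphere (p + r *: N p) r 0].

End Surfaces.

(* Main.v *)
Require Import Defs.
From mathcomp Require Import all_boot all_order all_algebra.
From mathcomp Require Import all_classical all_reals all_analysis.
From mathcomp Require Import ring lra.
Set Implicit Arguments.
Unset Strict Implicit.
Unset Printing Implicit Defensive.
Import Order.TTheory GRing.Theory Num.Theory.
Import numFieldNormedType.Exports.
Local Open Scope classical_set_scope.
Local Open Scope ring_scope.

(** Why the theorem is true.

As [K] does not vanish, the Gauss map is a local diffeomorphism to the unit
sphere.  For the metric that it pulls back, the position is
[p = psi N + grad psi], where [psi] is the support function, and the trace of the
inverse Weingarten matrix, [- 2 H / K], is [Laplacian psi + 2 psi].  The defining
equation of the surface then becomes [psi * Laplacian psi = |grad psi|^2]: the
function [log |psi|] is harmonic.  On a compact connected surface the strong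
maximum principle makes [psi] constant, so [grad psi = 0] and [p = psi N] stays on
a sphere about the origin.

The maximum principle takes the following global form.  For a unit vector
[a] and [b > 1] the function [- log (b - <x, a>)] of [x] in the unit sphere is
strictly subharmonic outside a cap around [a] that shrinks to [a] as [b] tends to
[1].  Therefore [psi ^+ 2n / (b - <N, a>)] attains its maximum over the surface at a
point whose normal is in the cap ([touching_le0]).  Taking [b] close to [1] and [n]
large shows that every unit vector [a] is the normal at some maximum of
[psi ^+ 2] ([maxima_onto]).  At a maximum [p = psi N] ([max_position]), and the use
of [a] and [- a] together shows that the whole sphere of radius [max |psi|] consists
of maxima ([sphere_sub_max]).  Since the Gauss map is locally injective, the surface
has no other points near that sphere, so the maxima form an open and closed part
of the surface ([max_set_open], [max_set_closed]), and connectedness concludes. *)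

(** * Derivatives and maxima *)

Section Calculus.
Context {R : realType}.
Implicit Types (V : normedModType R).

(** If [d > 0] then [f1], which vanishes at [0], is positive just to the right
of [0], and the mean value theorem makes [f] increase there. *)
Lemma second_derivative_test1 (f f1 : R -> R) (e d : R) : 0 < e ->
  (forall t : R, `|t| < e -> is_derive t (1 : R) f (f1 t)) ->
  is_derive (0 : R) (1 : R) f1 d ->
  (forall t : R, `|t| < e -> f t <= f 0) -> f1 0 = 0 /\ d <= 0.
Proof.
move=> e0 df df1 fmax.
have absP t : (t \in `]- e, e[) = (`|t| < e) by rewrite in_itv /= ltr_norml.
have f10 : f1 0 = 0.
  have d0 : is_derive (0 : R) (1 : R) f 0.
    apply: (@derive1_at_max _ f (- e) e); first by lra.
    - by move=> t; rewrite absP => /df [].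
    - by rewrite absP normr0.
    - by move=> t; rewrite absP; exact: fmax.
  by rewrite -(@derive_val _ _ _ _ _ _ _ (df 0 _)) ?normr0// derive_val.
split=> //; rewrite leNgt; apply/negP => d0.
have [dvb dval] := df1.
have : \forall h \near 0^', 0 < h^-1 * f1 h.
  have : (h^-1 *: (f1 (h *: 1 + 0) - f1 0)) @[h --> 0^'] --> d.
    by rewrite -dval; exact: dvb.
  move/cvgr_gt => /(_ _ d0); apply: filterS => h.
  by rewrite f10 subr0 addr0 [_%:A]mulr1.
rewrite near_withinE => /nbhs_ballP [r /= r0 rP].
pose h := Num.min e r / 2.
have mr : 0 < Num.min e r by rewrite lt_min e0 r0.
have me : Num.min e r <= e by rewrite ge_min lexx.
have mr' : Num.min e r <= r by rewrite ge_min lexx orbT.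
have h0 : 0 < h by rewrite /h; lra.
have [||c cI cE] := @MVT _ f f1 0 h h0.
- move=> x; rewrite in_itv /= => /andP[x0 xh]; apply: df.
  by rewrite ger0_norm ?ltW//; rewrite /h in xh; lra.
- apply/continuous_in_subspaceT => x; rewrite inE /= in_itv /= => /andP[x0 xh].
  apply/differentiable_continuous/derivable1_diffP.
  have xe : `|x| < e by rewrite ger0_norm//; rewrite /h in xh; lra.
  by case: (df x xe).
have := cI; rewrite in_itv /= => /andP[c0 ch].
have cr : ball 0 r c.
  by rewrite /ball /= sub0r normrN gtr0_norm//; rewrite /h in ch; lra.
have := rP _ cr; rewrite gt_eqF// => /(_ isT).
rewrite pmulr_rgt0 ?invr_gt0// => fc0.
have : f h <= f 0 by apply: fmax; rewrite gtr0_norm// /h; lra.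
have : 0 < f1 c * (h - 0) by rewrite subr0 mulr_gt0.
lra.
Qed.

Lemma is_derive_line V (f : V -> R) (x v : V) (t d : R) :
  is_derive (t *: v + x) v f d -> is_derive t (1 : R) (fun h : R => f (h *: v + x)) d.
Proof.
have E : (fun h : R => h^-1 *: (f ((h *: 1 + t) *: v + x) - f (t *: v + x))) =
         (fun h : R => h^-1 *: ((f \o shift (t *: v + x)) (h *: v) - f (t *: v + x))).
  apply/funext => h /=; congr (_ *: (f _ - _)).
  by rewrite [h *: 1]mulr1 scalerDl addrA.
case=> dvb dval; split.
  by move: dvb; rewrite /derivable /= E.
by rewrite -dval /derive /= E.
Qed.

Lemma second_derivative_test V (U : set V) (g g1 : V -> R) (u s : V) (d : R) :
  open U -> U u -> (forall x, U x -> is_derive x s g (g1 x)) ->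
  is_derive u s g1 d -> (forall x, U x -> g x <= g u) -> g1 u = 0 /\ d <= 0.
Proof.
move=> oU Uu dg dg1 gmax.
have : \forall t \near (0 : R), U (t *: s + u).
  have : (fun t : R => t *: s + u) t @[t --> 0] --> 0 *: s + u.
    by apply: cvgD; [apply: cvgZr_tmp|exact: cvg_cst].
  rewrite scale0r add0r => /(_ U); apply.
  exact: open_nbhs_nbhs.
move=> /nbhs_ballP [e /= e0 eP].
have eU t : `|t| < e -> U (t *: s + u).
  by move=> te; apply: eP; rewrite /ball /= sub0r normrN.
have := @second_derivative_test1 (fun t => g (t *: s + u)) (fun t => g1 (t *: s + u)) e d e0.
rewrite scale0r add0r; apply.
- by move=> t /eU Ut; apply: is_derive_line; exact: dg.
- by apply: is_derive_line; rewrite scale0r add0r.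
- by move=> t /eU; exact: gmax.
Qed.

Lemma is_derive_powS V (f : V -> R) x v df k :
  is_derive x v f df ->
  is_derive x v (fun y => f y ^+ k.+1) (k.+1%:R * f x ^+ k * df).
Proof.
move=> h; have := is_deriveX k.+1 h.
by rewrite (_ : (fun y => _) = f ^+ k.+1) ?exprfctE.
Qed.

Lemma is_derive_mul V (f g : V -> R) x v df dg :
  is_derive x v f df -> is_derive x v g dg ->
  is_derive x v (fun y => f y * g y) (df * g x + f x * dg).
Proof.
move=> hf hg; have := is_deriveM hf hg.
by rewrite addrC /GRing.scale /= (mulrC (g x)).
Qed.

Lemma is_derive_mulc V (f : V -> R) x v df c :
  is_derive x v f df -> is_derive x v (fun y => c * f y) (c * df).
Proof. by move=> hf; have := is_deriveZ c hf. Qed.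

Lemma is_derive_coord V n (f : V -> 'rV[R]_n) x v df i :
  is_derive x v f df -> is_derive x v (fun y => f y ord0 i) (df ord0 i).
Proof.
case=> dvb dval; split; first exact: (derivable_mxP f x v).1.
by rewrite -dval derive_mx// mxE.
Qed.

Lemma is_derive_dot V n (f g : V -> 'rV[R]_n) x v df dg :
  is_derive x v f df -> is_derive x v g dg ->
  is_derive x v (fun y => dot (f y) (g y)) (dot df (g x) + dot (f x) dg).
Proof.
move=> hf hg.
rewrite (_ : (fun y => _) = \sum_(i < n) (fun y => f y ord0 i * g y ord0 i)); last first.
  by apply/funext => y; rewrite fct_sumE.
rewrite (_ : _ + _ = \sum_(i < n)
    (f x ord0 i *: dg ord0 i + g x ord0 i *: df ord0 i)); last first.
  rewrite /dot addrC -big_split /=; apply: eq_bigr => i _.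
  by rewrite /GRing.scale /= [g _ _ _ * _]mulrC.
apply: is_derive_sum => i.
by apply: is_deriveM; exact: is_derive_coord.
Qed.

Lemma is_derive_dotl V n (f : V -> 'rV[R]_n) x v df (a : 'rV[R]_n) :
  is_derive x v f df -> is_derive x v (fun y => dot (f y) a) (dot df a).
Proof.
move=> hf; have := is_derive_dot hf (is_derive_cst a x v).
have -> : dot (f x) 0 = 0 by rewrite /dot big1// => i _; rewrite mxE mulr0.
by rewrite addr0.
Qed.

Lemma ball_segment V (u v w : V) (r t : R) :
  ball u r v -> ball u r w -> 0 <= t -> t <= 1 -> ball u r (t *: (w - v) + v).
Proof.
rewrite -!ball_normE /= => bv bw t0 t1.
have -> : u - (t *: (w - v) + v) = (1 - t) *: (u - v) + t *: (u - w).
  rewrite opprD addrA addrAC -scalerN opprB scalerBl scale1r.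
  by rewrite -[RHS]addrA [- _ + _]addrC -scalerBr opprB [u - w + _]addrC subrKA.
apply: le_lt_trans (ler_normD _ _) _; rewrite !normrZ !ger0_norm ?subr_ge0//.
set x := `|u - v| in bv *; set y := `|u - w| in bw *.
pose m := Num.max x y.
have mr : m < r by rewrite gt_max bv bw.
apply: le_lt_trans mr.
have -> : m = (1 - t) * m + t * m by ring.
by apply: lerD; apply: ler_wpM2l; rewrite ?subr_ge0// le_max lexx ?orbT.
Qed.

Lemma cvg_dot T (F : set_system T) (FF : Filter F) n (f g : T -> 'rV[R]_n) a b :
  f @ F --> a -> g @ F --> b -> dot (f x) (g x) @[x --> F] --> dot a b.
Proof.
move=> fa gb; rewrite /dot; apply: cvg_big; first exact: add_continuous.
move=> i _; apply: cvgM.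
- exact: (cvg_comp _ _ fa (@coord_continuous R 1 n ord0 i a)).
- exact: (cvg_comp _ _ gb (@coord_continuous R 1 n ord0 i b)).
Qed.

End Calculus.

(** * Euclidean linear algebra *)

Section EuclideanAlgebra.
Context {R : realType}.

Lemma sum_ord2 (V : nmodType) (F : 'I_2 -> V) : \sum_i F i = F 0 + F 1.
Proof.
rewrite !big_ord_recl big_ord0 addr0; congr (_ + F _); exact/val_inj.
Qed.

Lemma dot_mulmx n (u v : 'rV[R]_n) : dot u v = (u *m v^T) ord0 ord0.
Proof. by rewrite /dot mxE; apply: eq_bigr => i _; rewrite mxE. Qed.

Lemma dotC n (u v : 'rV[R]_n) : dot u v = dot v u.
Proof. by rewrite /dot; apply: eq_bigr => i _; rewrite mulrC. Qed.

Lemma dotDl n (u v w : 'rV[R]_n) : dot (u + v) w = dot u w + dot v w.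
Proof. by rewrite !dot_mulmx mulmxDl mxE. Qed.

Lemma dotZl n a (u w : 'rV[R]_n) : dot (a *: u) w = a * dot u w.
Proof. by rewrite !dot_mulmx -scalemxAl mxE. Qed.

Lemma dotNl n (u w : 'rV[R]_n) : dot (- u) w = - dot u w.
Proof. by rewrite -scaleN1r dotZl mulN1r. Qed.

Lemma dotBl n (u v w : 'rV[R]_n) : dot (u - v) w = dot u w - dot v w.
Proof. by rewrite dotDl dotNl. Qed.

Lemma dot0l n (w : 'rV[R]_n) : dot 0 w = 0.
Proof. by rewrite -(scale0r w) dotZl mul0r. Qed.

Lemma dotDr n (u v w : 'rV[R]_n) : dot w (u + v) = dot w u + dot w v.
Proof. by rewrite dotC dotDl !(dotC w). Qed.

Lemma dotZr n a (u w : 'rV[R]_n) : dot w (a *: u) = a * dot w u.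
Proof. by rewrite dotC dotZl dotC. Qed.

Lemma dotNr n (u w : 'rV[R]_n) : dot w (- u) = - dot w u.
Proof. by rewrite dotC dotNl dotC. Qed.

Lemma dotBr n (u v w : 'rV[R]_n) : dot w (u - v) = dot w u - dot w v.
Proof. by rewrite dotDr dotNr. Qed.

Lemma dot_ge0 n (u : 'rV[R]_n) : 0 <= dot u u.
Proof. by apply: sumr_ge0 => i _; rewrite -expr2 sqr_ge0. Qed.

Lemma dot_eq0 n (u : 'rV[R]_n) : (dot u u == 0) = (u == 0).
Proof.
apply/eqP/eqP => [u0|->]; last exact: dot0l.
apply/rowP => i; rewrite mxE; apply/eqP; rewrite -sqrf_eq0 expr2.
move/eqP: u0; rewrite psumr_eq0 => [/allP/(_ i (mem_index_enum _))//|j _].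
by rewrite -expr2 sqr_ge0.
Qed.

Lemma dot_gt0 n (u : 'rV[R]_n) : u != 0 -> 0 < dot u u.
Proof. by rewrite lt0r dot_eq0 dot_ge0 andbT. Qed.

Lemma dot_unit_eq n (u v : 'rV[R]_n) :
  dot u u = 1 -> dot v v = 1 -> 1 <= dot u v -> u = v.
Proof.
move=> u1 v1 uv; apply/eqP; rewrite -subr_eq0 -dot_eq0 eq_le dot_ge0 andbT.
by rewrite dotBl !dotBr u1 v1 (dotC v u); lra.
Qed.

Lemma dot_unit_le1 n (u v : 'rV[R]_n) :
  dot u u = 1 -> dot v v = 1 -> dot u v <= 1.
Proof. by move=> u1 v1; have := dot_ge0 (u - v); rewrite dotBl !dotBr u1 v1 (dotC v u); lra. Qed.

Lemma gram_entry m n (J : 'M[R]_(m, n)) i j :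
  (J *m J^T) i j = dot (row i J) (row j J).
Proof. by rewrite mxE /dot; apply: eq_bigr => k _; rewrite !mxE. Qed.

Lemma quadratic2_gt0 (a b c x y : R) : 0 < a -> b ^+ 2 < a * c ->
  (x != 0) || (y != 0) -> 0 < a * x ^+ 2 + 2 * b * x * y + c * y ^+ 2.
Proof.
move=> a0 h xy; rewrite -(pmulr_rgt0 _ a0).
have -> : a * (a * x ^+ 2 + 2 * b * x * y + c * y ^+ 2) =
  (a * x + b * y) ^+ 2 + (a * c - b ^+ 2) * y ^+ 2 by ring.
have [y0|y0] := eqVneq y 0.
  move: xy; rewrite y0 eqxx orbF => x0.
  rewrite !mulr0 addr0 expr0n mulr0 addr0 exprn_even_gt0//= mulf_neq0//.
  by rewrite gt_eqF.
apply: ltr_wpDl; first exact: sqr_ge0.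
by apply: mulr_gt0; [rewrite subr_gt0|rewrite exprn_even_gt0].
Qed.

(** The Gram matrix of two independent vectors is positive definite, in the form
of its leading minors that [quadratic2_gt0] needs. *)
Lemma gram2_gt0 n (J : 'M[R]_(2, n)) : row_free J ->
  let g i j := dot (row i J) (row j J) in
  0 < g 0 0 /\ (g 0 1) ^+ 2 < g 0 0 * g 1 1.
Proof.
move=> Jfree g.
have pos (x : 'rV[R]_2) : x != 0 ->
    0 < g 0 0 * x 0 0 ^+ 2 + 2 * g 0 1 * x 0 0 * x 0 1 + g 1 1 * x 0 1 ^+ 2.
  move=> x0; have : x *m J != 0 by rewrite mulmx_free_eq0.
  move=> /dot_gt0; rewrite mulmx_sum_row sum_ord2.
  rewrite !(dotDl, dotDr, dotZl, dotZr) (dotC (row 1 J) (row 0 J)).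
  by congr (0 < _); rewrite /g; ring.
have g0 : 0 < g 0 0.
  have := pos (\row_j (j == 0)%:R); rewrite !mxE/=.
  rewrite expr1n expr0n !mulr0 mulr1 !addr0; apply.
  by apply/eqP => /rowP/(_ 0)/eqP; rewrite !mxE oner_eq0.
split=> //.
have := pos (\row_j if j == 0 then - g 0 1 else g 0 0); rewrite !mxE/=.
have -> : g 0 0 * (- g 0 1) ^+ 2 + 2 * g 0 1 * (- g 0 1) * g 0 0 +
  g 1 1 * g 0 0 ^+ 2 = g 0 0 * (g 0 0 * g 1 1 - g 0 1 ^+ 2) by ring.
rewrite pmulr_rgt0// subr_gt0; apply.
apply/eqP => /rowP/(_ 1)/eqP; rewrite !mxE/=.
by rewrite gt_eqF.
Qed.

Lemma mx2_eq (A B : 'M[R]_2) : A 0 0 = B 0 0 -> A 0 1 = B 0 1 ->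
  A 1 0 = B 1 0 -> A 1 1 = B 1 1 -> A = B.
Proof.
move=> h00 h01 h10 h11; apply/matrixP.
have two (i : 'I_2) : (i = 0) \/ (i = 1).
  by case: i => [[|[|]]]//= h; [left|right]; exact/val_inj.
by move=> i j; case: (two i) => ->; case: (two j) => ->.
Qed.

(** Gram-Schmidt; the entries of the witness come from normalizing the first
row, and then the combination [a * row 1 - b * row 0] orthogonal to it. *)
Lemma orthonormal_combination n (J : 'M[R]_(2, n)) : row_free J ->
  exists S : 'M[R]_2, (S *m J) *m (S *m J)^T = 1%:M.
Proof.
move=> /gram2_gt0 /=.
set a := dot _ _; set b := dot (row 0 J) (row 1 J); set c := dot (row 1 J) _.
move=> [a0 abc].
set D := a * c - b ^+ 2; have D0 : 0 < D by rewrite subr_gt0.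
pose p := Num.sqrt a; pose q := Num.sqrt D.
have p0 : p != 0 by rewrite sqrtr_eq0 -ltNge.
have q0 : q != 0 by rewrite sqrtr_eq0 -ltNge.
have p2 : p ^+ 2 = a by rewrite sqr_sqrtr// ltW.
have q2 : q ^+ 2 = a * c - b ^+ 2 by rewrite sqr_sqrtr// ltW.
exists (\matrix_(i, j) if i == 0 then (if j == 0 then p^-1 else 0)
                      else (if j == 0 then - b / (p * q) else a / (p * q))).
rewrite trmx_mul mulmxA -(mulmxA _ J).
have G00 : (J *m J^T) 0 0 = a by rewrite gram_entry.
have G01 : (J *m J^T) 0 1 = b by rewrite gram_entry.
have G10 : (J *m J^T) 1 0 = b by rewrite gram_entry dotC.
have G11 : (J *m J^T) 1 1 = c by rewrite gram_entry.
move: (J *m J^T) G00 G01 G10 G11 => G G00 G01 G10 G11.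
have l1 : lift ord0 ord0 = 1 :> 'I_2 by exact/val_inj.
apply: mx2_eq; rewrite !mxE !big_ord_recl big_ord0 !mxE !big_ord_recl !big_ord0 l1 !mxE/= ?G00 ?G01 ?G10 ?G11 -p2.
all: try by field; rewrite ?p0 ?q0.
have -> : c = (q ^+ 2 + b ^+ 2) / p ^+ 2 by rewrite q2 p2; field; rewrite gt_eqF.
by field; rewrite p0 q0.
Qed.

(** A unit vector together with the rows of [F] is an orthonormal basis, because
[E *m E^T = 1] forces [E^T *m E = 1] for square matrices. *)
Lemma frame_parseval m n (F : 'M[R]_(m, n)) (v x y : 'rV[R]_n) : (m.+1 = n)%N ->
  dot v v = 1 -> F *m F^T = 1%:M -> (forall i, dot v (row i F) = 0) ->
  dot x y = dot x v * dot y v + \sum_i dot x (row i F) * dot y (row i F).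
Proof.
move=> mn; case: n / mn F v x y => F v x y v1 F1 vF.
pose E : 'M[R]_(1 + m) := col_mx v F.
have FvT : v *m F^T = 0.
  apply/rowP => i; rewrite !mxE -[RHS](vF i) /dot.
  by apply: eq_bigr => k _; rewrite !mxE.
have E1 : E *m E^T = 1%:M.
  rewrite /E tr_col_mx mul_col_row F1 FvT.
  have -> : F *m v^T = 0 by apply: trmx_inj; rewrite trmx_mul trmxK FvT trmx0.
  rewrite [RHS]scalar_mx_block; congr block_mx.
  by apply/rowP => i; rewrite !ord1 -dot_mulmx v1 mxE.
have {}E1 : E^T *m E = 1%:M by exact: mulmx1C.
have -> : dot x y = dot (x *m E^T) (y *m E^T).
  by rewrite !dot_mulmx trmx_mul trmxK mulmxA -(mulmxA x) E1 mulmx1.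
rewrite {1}/dot (@big_split_ord _ _ _ 1 m) /= big_ord1.
have lE (z : 'rV[R]_m.+1) : (z *m E^T) ord0 (lshift m ord0) = dot z v.
  rewrite /E tr_col_mx mul_mx_row.
  by rewrite dot_mulmx row_mxEl.
have rE (z : 'rV[R]_m.+1) i : (z *m E^T) ord0 (rshift 1 i) = dot z (row i F).
  rewrite /E tr_col_mx mul_mx_row row_mxEr mxE /dot.
  by apply: eq_bigr => k _; rewrite !mxE.
by rewrite !lE; congr (_ + _); apply: eq_bigr => i _; rewrite !rE.
Qed.

(** By dimension count: independent vectors orthogonal to [v], one fewer than
the dimension, span the whole hyperplane orthogonal to [v]. *)
Lemma row_sub_frame m n (v : 'rV[R]_n) (A : 'M[R]_(m, n)) : (m.+1 = n)%N ->
  v != 0 -> row_free A -> (forall i, dot v (row i A) = 0) ->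
  forall k (B : 'M[R]_(k, n)), (forall i, dot v (row i B) = 0) -> (B <= A)%MS.
Proof.
move=> mn v0 Afree vA k B vB.
have kerP l (C : 'M[R]_(l, n)) : (forall i, dot v (row i C) = 0) -> (C <= kermx v^T)%MS.
  move=> vC; apply/sub_kermxP/matrixP => i j; rewrite !mxE !ord1 -[RHS](vC i) dotC.
  by rewrite /dot; apply: eq_bigr => l' _; rewrite !mxE.
have rk : \rank (kermx v^T) = m.
  by rewrite mxrank_ker mxrank_tr rank_rV v0 -mn subn1.
have /mxrank_leqif_sup := kerP _ _ vA.
rewrite rk (eqP Afree) => -[_ /esym]; rewrite eqxx => kA.
exact: submx_trans (kerP _ _ vB) kA.
Qed.

Lemma trace_inv2 (W : 'M[R]_2) : \det W != 0 -> \tr (invmx W) = \tr W / \det W.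
Proof.
move=> W0; rewrite /invmx unitmxE unitfE W0 mxtraceZ mulrC; congr (_ / _).
rewrite /mxtrace !big_ord_recl !big_ord0 !mxE /cofactor !det_mx11 !mxE /=.
have -> : lift (lift ord0 ord0) 0 = ord0 :> 'I_2 by exact/val_inj.
have -> : lift ord0 0 = lift ord0 ord0 :> 'I_2 by exact/val_inj.
by rewrite /bump /=; ring.
Qed.

End EuclideanAlgebra.

(** * Maps from the plane: Jacobian and local injectivity *)

Section PlaneMaps.
Context {R : realType}.

(** The rows are the partial derivatives, so the differential acts on row
vectors by multiplication on the right. *)
Definition jac {n} (f : 'rV[R]_2 -> 'rV[R]_n) u : 'M[R]_(2, n) :=
  \matrix_i partial i f u.

Lemma derive_jac n (f : 'rV[R]_2 -> 'rV[R]_n) u v :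
  differentiable f u -> 'D_v f u = v *m jac f u.
Proof.
move=> df; rewrite deriveE// [in LHS](row_sum_delta v) linear_sum mulmx_sum_row.
by apply: eq_bigr => i _; rewrite linearZ rowK /partial deriveE.
Qed.

Lemma is_derive_diff n (f : 'rV[R]_2 -> 'rV[R]_n) u v :
  differentiable f u -> is_derive u v f ('D_v f u).
Proof. by move=> df; apply: derivableP; exact: diff_derivable. Qed.

(** If [f v = f w] with [s = w - v] nonzero, Rolle's theorem applied to the
component of [f] along [d = 'D_s f u] gives a point [x] of the segment where
['D_s f x] is orthogonal to ['D_s f u].  The scalar product of these two vectors
is a quadratic form in [s] whose coefficients depend continuously on [x] and
which is positive definite at [x = u], hence near [u]. *)
Lemma locally_injective n (f : 'rV[R]_2 -> 'rV[R]_n) (U : set 'rV[R]_2) u :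
  open U -> U u -> (forall x, U x -> differentiable f x) ->
  (forall i, {for u, continuous (partial i f)}) -> row_free (jac f u) ->
  exists2 r : R, 0 < r &
    forall v w, ball u r v -> ball u r w -> f v = f w -> v = w.
Proof.
move=> oU Uu df cf /gram2_gt0 [a0 abc].
have [P PE] : exists P, forall i, partial i f = P i by exists (partial^~ f).
(* [E] at [u] is the Gram matrix of the partial derivatives. *)
pose E i j v := dot (P i u) (P j v).
have Eu i j : dot (row i (jac f u)) (row j (jac f u)) = E i j u by rewrite !rowK !PE.
rewrite !Eu in a0 abc.
have Ec i j : E i j v @[v --> nbhs u] --> E i j u.
  apply: (@cvg_dot R _ (nbhs u) _); [exact: cvg_cst|rewrite -PE; exact: cf].
have pos : \forall v \near u, [/\ U v, 0 < E 0 0 v &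
    ((E 0 1 v + E 1 0 v) / 2) ^+ 2 < E 0 0 v * E 1 1 v].
  have near1 : \forall v \near u, 0 < E 0 0 v.
    by move: (Ec 0 0) => /cvgr_gt /(_ _ a0).
  have near2 : \forall v \near u,
      0 < E 0 0 v * E 1 1 v - ((E 0 1 v + E 1 0 v) / 2) ^+ 2.
    have : (E 0 0 v * E 1 1 v - ((E 0 1 v + E 1 0 v) / 2) ^+ 2) @[v --> nbhs u] -->
         E 0 0 u * E 1 1 u - ((E 0 1 u + E 1 0 u) / 2) ^+ 2.
      have Es : (E 0 1 v + E 1 0 v) / 2 @[v --> nbhs u] --> (E 0 1 u + E 1 0 u) / 2.
        by apply: cvgMr_tmp; apply: cvgD; exact: Ec.
      apply: cvgB; first by apply: cvgM; exact: Ec.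
      exact: (cvgM Es Es).
    move/cvgr_gt => /(_ 0); apply.
    have -> : E 1 0 u = E 0 1 u by rewrite /E dotC.
    by rewrite subr_gt0 (_ : (_ + _) / 2 = E 0 1 u)//; field.
  near=> v; split.
  - by near: v; exact: open_nbhs_nbhs.
  - by near: v.
  - by rewrite -subr_gt0; near: v.
have /nbhs_ballP [r /= r0 rP] := pos.
exists r => // v w bv bw fvw.
apply/eqP; rewrite eq_sym -subr_eq0; apply/negP => /negP s0.
set s := w - v in s0.
have segU t : 0 <= t -> t <= 1 -> ball u r (t *: s + v) by exact: ball_segment.
pose d := 'D_s f u.
pose h (t : R) := dot (f (t *: s + v)) d.
have dh (t : R) : 0 <= t -> t <= 1 ->
    is_derive t (1 : R) h (dot ('D_s f (t *: s + v)) d).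
  move=> t0 t1; apply: (@is_derive_line _ _ (fun x => dot (f x) d)).
  have [Ut _ _] := rP _ (segU t t0 t1).
  exact: is_derive_dotl (is_derive_diff s (df _ Ut)).
have [|||t] := @Rolle _ h 0 1 ltr01.
- move=> t; rewrite in_itv/= => /andP[/ltW t0 /ltW t1].
  by case: (dh t t0 t1).
- apply/continuous_in_subspaceT => t; rewrite inE /= in_itv /= => /andP[t0 t1].
  by apply/differentiable_continuous/derivable1_diffP; case: (dh t t0 t1).
- by rewrite /h scale0r add0r scale1r subrK fvw.
rewrite in_itv/= => /andP[/ltW t0 /ltW t1] [_ ht].
have [Ut E0 E1] := rP _ (segU t t0 t1).
have Df x : U x -> 'D_s f x = s 0 0 *: P 0 x + s 0 1 *: P 1 x.
  by move=> Ux; rewrite derive_jac ?mulmx_sum_row ?sum_ord2 ?rowK ?PE//; exact: df.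
have := dh t t0 t1 => -[_]; rewrite ht /d !Df//.
have -> (y : 'rV[R]_2) : dot (s 0 0 *: P 0 y + s 0 1 *: P 1 y)
    (s 0 0 *: P 0 u + s 0 1 *: P 1 u) =
  s 0 0 * (s 0 0 * E 0 0 y + s 0 1 * E 1 0 y) +
  s 0 1 * (s 0 0 * E 0 1 y + s 0 1 * E 1 1 y).
  by rewrite dotC !dotDl !dotZl !dotDr !dotZr /E; ring.
have s00 : (s 0 0 != 0) || (s 0 1 != 0).
  apply: contra_neqT s0; rewrite negb_or !negbK => /andP[/eqP s0 /eqP s1].
  apply/rowP => i; rewrite [RHS]mxE.
  case: i => [[|[|]]]//= hi; [rewrite -[RHS]s0|rewrite -[RHS]s1]; congr (s _ _); exact/val_inj.
have := quadratic2_gt0 E0 E1 s00.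
move: (E 0 0 _) (E 0 1 _) (E 1 0 _) (E 1 1 _) (s 0 0) (s 0 1) => e00 e01 e10 e11 x y.
move=> pos0 eq0.
move: pos0; rewrite (_ : _ + _ = 0) ?ltxx// eq0.
by field.
Unshelve. all: by end_near. Qed.

End PlaneMaps.

(** * Charts and the Gauss map *)

Section Chart.
Context {R : realType}.
Variables (S : set 'rV[R]_3) (N : 'rV[R]_3 -> 'rV[R]_3).
Variables (U : set 'rV[R]_2) (X : 'rV[R]_2 -> 'rV[R]_3).
Hypotheses (gauss : gauss_map S N) (chart : local_parameterization S U X).

Let n := N \o X.

Lemma chart_open : open U. Proof. by case: chart. Qed.

Lemma chart_nbhs u : U u -> nbhs u U.
Proof. by move=> Uu; apply: open_nbhs_nbhs; split => //; exact: chart_open. Qed.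

Lemma chart_mem u : U u -> S (X u).
Proof.
by case: chart => _ _ _ [V _ XU] _ Uu; have : (X @` U) (X u) by []; rewrite XU => -[].
Qed.

Lemma chart_diff u : U u -> differentiable X u.
Proof. by case: chart => _ /(_ 1%N) [+ _] _ _ _; exact. Qed.

Lemma normal_diff u : U u -> differentiable n u.
Proof. by case: (gauss chart) => /(_ 1%N) [+ _] _; exact. Qed.

Lemma partial_normal_diff i u : U u -> differentiable (partial i n) u.
Proof. by case: (gauss chart) => /(_ 2%N) [_ /(_ i) []]+ _ _; exact. Qed.

Lemma normal_unit u : U u -> dot (n u) (n u) = 1.
Proof. by case: (gauss chart) => _ + Uu => /(_ u Uu) []. Qed.

Lemma normal_tangent i u : U u -> dot (n u) (row i (jac X u)) = 0.
Proof. by case: (gauss chart) => _ + Uu => /(_ u Uu) [_ /(_ i)]; rewrite rowK. Qed.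

Lemma normal_tangentD s u : U u -> dot (n u) ('D_s X u) = 0.
Proof.
move=> Uu; rewrite derive_jac; last exact: chart_diff.
rewrite mulmx_sum_row sum_ord2 dotDr !dotZr !normal_tangent//.
by rewrite !mulr0 addr0.
Qed.

Lemma derive_normal_tangent s u : U u -> dot (n u) ('D_s n u) = 0.
Proof.
move=> Uu; have dn := is_derive_diff s (normal_diff Uu).
have d0 : is_derive u s (fun x => dot (n x) (n x)) 0.
  apply: (@near_eq_is_derive _ _ _ (cst (1 : R))).
  by apply: filterS (chart_nbhs Uu) => x Ux; rewrite normal_unit.
have := is_derive_dot dn dn => /(@derive_val _ _ _ _ _ _ _).
rewrite (@derive_val _ _ _ _ _ _ _ d0) (dotC ('D_s n u)); lra.
Qed.

Lemma chart_row_free u : U u -> row_free (jac X u).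
Proof.
move=> Uu; case: chart => _ _ /(_ u Uu) inj _ _.
apply: inj_row_free => v v0; apply: inj.
by rewrite linear0 -deriveE; [rewrite derive_jac//|]; exact: chart_diff.
Qed.

Lemma derive2_normal s u : U u ->
  is_derive u s ('D_s n) ('D_s ('D_s n) u).
Proof.
move=> Uu; apply: derivableP.
have h : is_derive u s (\sum_i (fun x => s ord0 i *: partial i n x))
    (\sum_i s ord0 i *: 'D_s (partial i n) u).
  apply: is_derive_sum => i; apply: is_deriveZ.
  exact: is_derive_diff (partial_normal_diff _ Uu).
suff : is_derive u s ('D_s n) (\sum_i s ord0 i *: 'D_s (partial i n) u) by case.
apply: near_eq_is_derive h.
apply: filterS (chart_nbhs Uu) => x Ux.
rewrite derive_jac; last exact: normal_diff.
rewrite fct_sumE mulmx_sum_row; apply: eq_bigr => i _.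
by rewrite rowK.
Qed.

(** Derivative of the identity [dot n ('D_s n) = 0]. *)
Lemma derive2_normal_dot s u : U u ->
  dot (n u) ('D_s ('D_s n) u) = - dot ('D_s n u) ('D_s n u).
Proof.
move=> Uu.
have d0 : is_derive u s (fun x => dot (n x) ('D_s n x)) 0.
  apply: (@near_eq_is_derive _ _ _ (cst (0 : R))).
  by apply: filterS (chart_nbhs Uu) => x Ux; rewrite derive_normal_tangent.
have dn := is_derive_diff s (normal_diff Uu).
have := is_derive_dot dn (derive2_normal s Uu) => /(@derive_val _ _ _ _ _ _ _).
rewrite (@derive_val _ _ _ _ _ _ _ d0); lra.
Qed.

(** The matrix chosen in [weingarten] exists because the derivatives of the
normal are tangent, and [jac X u] spans the tangent plane. *)
Lemma weingartenE u : U u -> jac n u = weingarten N X u *m jac X u.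
Proof.
move=> Uu; have : exists W : 'M[R]_2, jac n u = W *m jac X u.
  apply/submxP; apply: (row_sub_frame (v := n u)) => //.
  - by rewrite -dot_eq0 normal_unit// oner_eq0.
  - exact: chart_row_free.
  - by move=> i; exact: normal_tangent.
  - by move=> i; rewrite rowK; exact: derive_normal_tangent.
move=> [W WE].
have : [set W : 'M[R]_2 | forall i : 'I_2,
         partial i (N \o X) u = \sum_(j < 2) W i j *: partial j X u] W.
  move=> i /=; have := congr1 (row i) WE; rewrite rowK => ->.
  rewrite row_mul mulmx_sum_row; apply: eq_bigr => j _.
  by rewrite rowK mxE.
move=> PW; have H := getPex (ex_intro _ W PW); apply/row_matrixP => i; rewrite rowK H.
rewrite row_mul mulmx_sum_row; apply: eq_bigr => j _.
by rewrite rowK mxE.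
Qed.

Lemma normal_row_free u : U u -> gauss_curvature N X u != 0 -> row_free (jac n u).
Proof.
move=> Uu K0; rewrite weingartenE// /row_free mxrankMfree ?chart_row_free//.
by apply/eqP/mxrank_unit; rewrite unitmxE unitfE.
Qed.

(** The Gauss map being an immersion, there are parameter directions along which
the derivatives of the normal form an orthonormal basis of the tangent plane.
In these directions the sum of the second derivatives is the Laplacian of the
metric pulled back from the unit sphere, up to terms of first order; the second
clause is the trace of the inverse of the Weingarten matrix. *)
Lemma orthonormal_directions u : U u -> gauss_curvature N X u != 0 ->
  exists s : 'I_2 -> 'rV[R]_2,
  [/\ forall i, dot ('D_(s i) n u) ('D_(s i) n u) = 1,
      \sum_i dot ('D_(s i) X u) ('D_(s i) n u) =
        - 2 * (mean_curvature N X u / gauss_curvature N X u)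
    & forall x y, dot x y = dot x (n u) * dot y (n u) +
        \sum_i dot x ('D_(s i) n u) * dot y ('D_(s i) n u)].
Proof.
move=> Uu K0; have Jfree := normal_row_free Uu K0.
have [Q Q1] := orthonormal_combination Jfree.
have W0 : weingarten N X u \in unitmx by rewrite unitmxE unitfE.
set W := weingarten N X u in W0.
have JX : jac X u = invmx W *m jac n u by rewrite weingartenE// mulKmx.
exists (fun i => row i Q).
have dn i : 'D_(row i Q) n u = row i (Q *m jac n u).
  by rewrite derive_jac; [rewrite row_mul|exact: normal_diff].
have dX i : 'D_(row i Q) X u = row i (Q *m jac X u).
  by rewrite derive_jac; [rewrite row_mul|exact: chart_diff].
have dotQ m (A B : 'M[R]_(2, m)) i : dot (row i A) (row i B) = (A *m B^T) i i.
  by rewrite mxE /dot; apply: eq_bigr => k _; rewrite !mxE.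
split.
- by move=> i; rewrite dn dotQ Q1 mxE eqxx.
- under eq_bigr do rewrite dn dX dotQ.
  rewrite -/(\tr _).
  have -> : Q *m jac X u *m (Q *m jac n u)^T =
            Q *m (invmx W *m (jac n u *m (jac n u)^T *m Q^T)).
    by rewrite trmx_mul JX !mulmxA.
  have : Q *m (jac n u *m (jac n u)^T *m Q^T) = 1%:M.
    by rewrite -Q1 trmx_mul !mulmxA.
  move=> /mulmx1C GQ; rewrite mxtrace_mulC -[X in \tr X]mulmxA GQ mulmx1.
  rewrite trace_inv2// /mean_curvature /gauss_curvature -/W.
  by field; rewrite unitmxE unitfE in W0.
- move=> x y; under eq_bigr do rewrite dn.
  apply: (@frame_parseval R 2 3) => //; first exact: normal_unit.
  by move=> i; rewrite -dn derive_normal_tangent.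
Qed.

(** The term with [dot ('D_s X u) (n u)] drops out: [X] moves tangentially. *)
Lemma support_derive s u : U u ->
  is_derive u s (fun x => dot (X x) (n x)) (dot (X u) ('D_s n u)).
Proof.
move=> Uu.
have dn := is_derive_diff s (normal_diff Uu).
have dX := is_derive_diff s (chart_diff Uu).
have := is_derive_dot dX dn.
by rewrite dotC normal_tangentD// add0r.
Qed.

End Chart.

Section Local.
Context {R : realType}.
Variables (S : set 'rV[R]_3) (N : 'rV[R]_3 -> 'rV[R]_3).

(** The image of a chart is relatively open, so that limits within the image and
limits within the whole surface agree. *)
Lemma chart_inverse U X u : local_parameterization S U X -> U u ->
  exists Y : 'rV[R]_3 -> 'rV[R]_2,
    Y @ within S (nbhs (X u)) --> u /\
    \forall q \near within S (nbhs (X u)), U (Y q) /\ X (Y q) = q.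
Proof.
move=> [_ _ _ [V oV XU] [Y [YX Yc]]] Uu.
have VXu : V (X u) by have : (X @` U) (X u) by []; rewrite XU => -[].
have nV : nbhs (X u) V by exact: open_nbhs_nbhs.
exists Y; split; last first.
  rewrite near_withinE; apply: filterS nV => q Vq Sq.
  have : (X @` U) q by rewrite XU.
  by move=> [v Uv <-]; rewrite YX.
have : Y @ within (X @` U) (nbhs (X u)) --> Y (X u).
  by move/subspace_continuousP : Yc; apply.
rewrite YX// XU => h B /h /=; rewrite !near_simpl !near_withinE => h'.
near=> q => Sq; have : V q by near: q.
move: Sq; near: q; apply: filterS h' => q + Sq Vq; exact.
Unshelve. all: by end_near. Qed.

Lemma normal_cvg p : regular_surface S -> gauss_map S N -> S p ->
  N q @[q --> within S (nbhs p)] --> N p.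
Proof.
move=> [_ reg] gauss /reg [U [X [c [u Uu <-]]]].
have [Y [Yu XY]] := chart_inverse c Uu.
have cn : {for u, continuous (N \o X)}.
  exact: differentiable_continuous (normal_diff gauss c Uu).
apply: cvg_trans (cvg_comp _ _ Yu cn).
apply: near_eq_cvg; apply: filterS XY => q [_ E] /=.
by rewrite E.
Qed.

End Local.

(** * Touching functions of the normal *)

Section Touching.
Context {R : realType}.

(** The computation behind [touching_le0], with [K] the exponent, [P] the power
[psi ^+ (K - 2)], [t] the component of [a] along the normal, and [xi], [yi] the
components of the position and of [a] along the tangent directions.  Adding the
second-order conditions and eliminating [rho] gives
[K ^+ 2 * P * (x0 ^+ 2 + x1 ^+ 2) <= 2 * M * t]; the first-order conditions turn
the left side into a multiple of [1 - t ^+ 2]. *)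
Lemma touching_algebra (K P psi M b t rho L x0 x1 y0 y1 h0 h1 z0 z1 w0 w1 : R) :
  K * (P * psi) * x0 = - (M * y0) -> K * (P * psi) * x1 = - (M * y1) ->
  K * (P * psi) * z0 + M * w0 = - (K * (P * psi) * psi + M * t) ->
  K * (P * psi) * z1 + M * w1 = - (K * (P * psi) * psi + M * t) ->
  K * ((K - 1) * P * x0) * x0 + K * (P * psi) * (h0 + z0) + M * w0 <= 0 ->
  K * ((K - 1) * P * x1) * x1 + K * (P * psi) * (h1 + z1) + M * w1 <= 0 ->
  h0 + h1 = rho -> L = psi * psi + (x0 * x0 + x1 * x1) ->
  1 = t * t + (y0 * y0 + y1 * y1) -> L + psi ^+ 2 = psi * rho ->
  P * psi * psi = M * (b - t) -> 0 < M -> t < b ->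
  1 - 2 * b * t + t ^+ 2 <= 0.
Proof.
move=> g0 g1 s0 s1 le0 le1 <- -> sum_y RT eqM M0 tb.
set T := x0 * x0 + x1 * x1 in RT.
have grad2 : (K * (P * psi)) ^+ 2 * T = M ^+ 2 * (1 - t ^+ 2).
  transitivity ((K * (P * psi) * x0) ^+ 2 + (K * (P * psi) * x1) ^+ 2).
    by rewrite /T; ring.
  by rewrite g0 g1 [in RHS]sum_y; ring.
have le_sum : K ^+ 2 * P * T <= 2 * M * t.
  rewrite -subr_le0; apply: le_trans (_ : _ <= 0 + 0) _; last by rewrite addr0.
  apply: le_trans (lerD le0 le1); rewrite le_eqVlt; apply/orP; left; apply/eqP.
  transitivity (K * ((K - 1) * P * T + P * (psi * (h0 + h1))) +
      (K * (P * psi) * z0 + M * w0) + (K * (P * psi) * z1 + M * w1)).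
    by rewrite s0 s1 -RT; ring.
  by rewrite /T; ring.
have D0 : 0 < M * (b - t) by rewrite mulr_gt0// subr_gt0.
have : (K ^+ 2 * P * T) * (M * (b - t)) <= (2 * M * t) * (M * (b - t)).
  by rewrite ler_pM2r.
have -> : K ^+ 2 * P * T * (M * (b - t)) = (K * (P * psi)) ^+ 2 * T.
  by rewrite -eqM; ring.
rewrite grad2 -subr_ge0.
have -> : 2 * M * t * (M * (b - t)) - M ^+ 2 * (1 - t ^+ 2) =
  M ^+ 2 * (- (1 - 2 * b * t + t ^+ 2)) by ring.
by rewrite pmulr_rge0 ?exprn_gt0// oppr_ge0.
Qed.

Variables (S : set 'rV[R]_3) (N : 'rV[R]_3 -> 'rV[R]_3).
Hypothesis rt : rt_surface S N.
Local Notation psi := (support_function N).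

Lemma rt_gauss : gauss_map S N. Proof. by case: rt. Qed.

Lemma rt_chart p : S p -> exists U X u,
  [/\ local_parameterization S U X, U u & X u = p].
Proof.
by case: rt => -[_ h] _ _ /h [U [X [c [u Uu <-]]]]; exists U, X, u.
Qed.

(** The sphere condition, expanded and combined with [|N| = 1]. *)
Lemma rt_identity U X u : local_parameterization S U X -> U u ->
  gauss_curvature N X u != 0 /\
  dot (X u) (X u) + psi (X u) ^+ 2 =
    psi (X u) * (- 2 * (mean_curvature N X u / gauss_curvature N X u)).
Proof.
move=> c Uu; case: rt => _ gauss /(_ U X c u Uu) [K0].
set r := _ + _; rewrite /sphere /= sub0r dotNl dotNr opprK.
rewrite !(dotDl, dotDr, dotZl, dotZr) (dotC (N _) (X u)).
rewrite (normal_unit gauss c Uu) -/(psi (X u)) => h; split=> //.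
by rewrite /r in h; lra.
Qed.

(** The condition on the surface says that [log |psi|] is harmonic for the
metric pulled back by the Gauss map, whereas on the unit sphere the Laplacian of
[- log (b - t)], with [t] the component along [a], has the sign of
[1 - 2 * b * t + t ^+ 2].  So [k.+2 * log |psi| - log (b - t)] is strictly
subharmonic where that number is positive, and has no maximum there.  Written
with powers instead of logarithms, this is the second derivative test for
[psi ^+ k.+2 + M * t] in the directions of [orthonormal_directions]. *)
Lemma touching_le0 k (M b : R) a p : dot a a = 1 -> 0 < M ->
  S p -> dot (N p) a < b ->
  (forall q, S q -> psi q ^+ k.+2 <= M * (b - dot (N q) a)) ->
  psi p ^+ k.+2 = M * (b - dot (N p) a) ->
  1 - 2 * b * dot (N p) a + dot (N p) a ^+ 2 <= 0.
Proof.
move=> a1 M0 Sp tb le_touch eq_touch.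
have [U [X [u [c Uu Xu]]]] := rt_chart Sp.
have gauss := rt_gauss.
have [K0 RT] := rt_identity c Uu.
have [s [s1 tr parseval]] := orthonormal_directions gauss c Uu K0.
move: tr; rewrite Xu in RT *; move: RT; set rho := - 2 * _ => RT tr.
set n := N \o X in s1 tr parseval *.
have nu : n u = N p by rewrite /n /= Xu.
have nss i := derive2_normal_dot gauss c (s i) Uu.
have test i : k.+2%:R * psi p ^+ k.+1 * dot p ('D_(s i) n u) +
                M * dot ('D_(s i) n u) a = 0 /\
   k.+2%:R * (k.+1%:R * psi p ^+ k * dot p ('D_(s i) n u)) * dot p ('D_(s i) n u) +
   k.+2%:R * psi p ^+ k.+1 * (dot ('D_(s i) X u) ('D_(s i) n u) +
      dot p ('D_(s i) ('D_(s i) n) u)) +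
   M * dot ('D_(s i) ('D_(s i) n) u) a <= 0.
  pose g v := dot (X v) (n v) ^+ k.+2 + M * dot (n v) a.
  pose g1 v := k.+2%:R * dot (X v) (n v) ^+ k.+1 * dot (X v) ('D_(s i) n v) +
               M * dot ('D_(s i) n v) a.
  have dn v : U v -> is_derive v (s i) n ('D_(s i) n v).
    by move=> Uv; apply: is_derive_diff; exact: (normal_diff gauss c).
  have dsupp v : U v ->
      is_derive v (s i) (fun x => dot (X x) (n x)) (dot (X v) ('D_(s i) n v)).
    by move=> Uv; exact: (support_derive gauss c).
  have dg v : U v -> is_derive v (s i) g (g1 v).
    move=> Uv; apply: is_deriveD; first exact: is_derive_powS (dsupp v Uv).
    exact: is_derive_mulc (is_derive_dotl a (dn v Uv)).
  have ds2 := derive2_normal gauss c (s i) Uu.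
  have dX : is_derive u (s i) X ('D_(s i) X u).
    by apply: is_derive_diff; exact: (chart_diff c).
  have psiu : dot (X u) (n u) = psi p by rewrite Xu nu.
  have dg1 : is_derive u (s i) g1 (
      (k.+2%:R * (k.+1%:R * dot (X u) (n u) ^+ k * dot (X u) ('D_(s i) n u)))
        * dot (X u) ('D_(s i) n u) +
      k.+2%:R * dot (X u) (n u) ^+ k.+1 *
        (dot ('D_(s i) X u) ('D_(s i) n u) + dot (X u) ('D_(s i) ('D_(s i) n) u)) +
      M * dot ('D_(s i) ('D_(s i) n) u) a).
    apply: is_deriveD.
      apply: is_derive_mul; last exact: is_derive_dot.
      exact: is_derive_mulc (is_derive_powS k (dsupp u Uu)).
    exact: is_derive_mulc (is_derive_dotl a ds2).
  have gmax v : U v -> g v <= g u.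
    move=> Uv; have := le_touch _ (chart_mem c Uv).
    rewrite /g psiu eq_touch nu -[support_function N (X v)]/(dot (X v) (n v)).
    by rewrite -[N (X v)]/(n v); lra.
  have := second_derivative_test (chart_open c) Uu dg dg1 gmax.
  by rewrite /g1 psiu Xu.
(* Opaque names for the derivatives: from here on only their scalar products
   matter. *)
have [e eE] : exists e, forall i, 'D_(s i) n u = e i by exists (fun i => 'D_(s i) n u).
have [f fE] : exists f, forall i, 'D_(s i) ('D_(s i) n) u = f i.
  by exists (fun i => 'D_(s i) ('D_(s i) n) u).
have [d dE] : exists d, forall i, 'D_(s i) X u = d i by exists (fun i => 'D_(s i) X u).
have par x y : dot x y = dot x (N p) * dot y (N p) +
    (dot x (e 0) * dot y (e 0) + dot x (e 1) * dot y (e 1)).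
  by rewrite parseval sum_ord2 nu !eE.
have {}s1 i : dot (e i) (e i) = 1 by rewrite -eE.
have {}nss i : dot (f i) (N p) = - 1.
  by move: (nss i); rewrite -/n nu eE fE s1 dotC.
have {}tr : dot (d 0) (e 0) + dot (d 1) (e 1) = rho.
  by rewrite -tr sum_ord2 !eE !dE.
move: test.
set K2 : R := k.+2%:R.
have -> : k.+1%:R = K2 - 1 by rewrite /K2 -[in RHS]addn1 natrD addrK.
move: K2 => K2 test.
have {}test i : K2 * (psi p ^+ k * psi p) * dot p (e i) + M * dot (e i) a = 0 /\
   K2 * ((K2 - 1) * psi p ^+ k * dot p (e i)) * dot p (e i) +
   K2 * (psi p ^+ k * psi p) * (dot (d i) (e i) + dot p (f i)) +
   M * dot (f i) a <= 0.
  by have := test i; rewrite eE fE dE exprSr.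
rewrite !exprSr in eq_touch.
(* The first-order conditions say that [c1 *: p + M *: a] is orthogonal to both
   [e i], hence a multiple of [N p]; so its product with the second derivatives
   [f i] only involves their normal parts, which are known. *)
pose c1 := K2 * (psi p ^+ k * psi p).
have grad i : c1 * dot p (e i) = - (M * dot (e i) a).
  by have [+ _] := test i; rewrite -/c1; lra.
have second i : c1 * dot p (f i) + M * dot (f i) a =
                - (c1 * psi p + M * dot (N p) a).
  have -> : c1 * dot p (f i) + M * dot (f i) a = dot (c1 *: p + M *: a) (f i).
    by rewrite dotDl !dotZl (dotC a).
  have orth j : dot (c1 *: p + M *: a) (e j) = 0.
    by rewrite dotDl !dotZl grad (dotC a) addNr.
  rewrite par !orth nss !mul0r !addr0 mulrN1.
  by rewrite dotDl !dotZl (dotC a).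
have [_ le0] := test 0; have [_ le1] := test 1.
have := par p p; rewrite -/(psi p) => sum_x.
have := par a a; rewrite a1 (dotC a (N p)) => sum_y.
move: (second 0) (second 1) (grad 0) (grad 1) => {second grad test}.
rewrite (dotC (e 0) a) (dotC (e 1) a) in sum_y *.
rewrite /c1 => second0 second1 grad0 grad1.
exact: (touching_algebra grad0 grad1 second0 second1 le0 le1 tr sum_x sum_y RT
  eq_touch M0 tb).
Qed.

End Touching.

(** * Maxima of the support function *)

Section Maxima.
Context {R : realType}.
Variables (S : set 'rV[R]_3) (N : 'rV[R]_3 -> 'rV[R]_3).
Hypothesis rt : rt_surface S N.
Hypothesis compactS : compact S.
Local Notation psi := (support_function N).

Lemma rt_normal_unit p : S p -> dot (N p) (N p) = 1.
Proof.
move=> /(rt_chart rt) [U [X [u [c Uu <-]]]].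
exact: (normal_unit (rt_gauss rt) c Uu).
Qed.

Lemma rt_normal_cvg p : S p -> N q @[q --> within S (nbhs p)] --> N p.
Proof. by move=> Sp; apply: normal_cvg => //; [case: rt|exact: rt_gauss]. Qed.

Lemma support_cvg p : S p -> psi q @[q --> within S (nbhs p)] --> psi p.
Proof.
move=> Sp; apply: (@cvg_dot R _ (within S (nbhs p)) _).
  exact: cvg_within.
exact: rt_normal_cvg.
Qed.

Lemma exists_max (f : 'rV[R]_3 -> R) :
  (forall p, S p -> f q @[q --> within S (nbhs p)] --> f p) ->
  exists2 p, S p & forall q, S q -> f q <= f p.
Proof.
move=> fc; have S0 : S !=set0 by case: rt => -[].
have [p] := @EVT_max_rV R 3 f S S0 compactS ((subspace_continuousP S f).2 fc).
by rewrite inE => Sp fp; exists p => // q Sq; apply: fp; rewrite inE.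
Qed.

(** Otherwise the identity of the surface reduces to [dot p p = 0], so that the
surface would be the origin alone and its charts would not be immersions. *)
Lemma support_neq0 : exists2 p, S p & psi p != 0.
Proof.
apply: contrapT => h.
have psi0 p : S p -> psi p = 0.
  by move=> Sp; apply/eqP; apply/negP => /negP ?; apply: h; exists p.
have [p Sp] : S !=set0 by case: rt => -[].
have [U [X [u [c Uu Xu]]]] := rt_chart rt Sp.
have X0 v : U v -> X v = 0.
  move=> Uv; have [_] := rt_identity rt c Uv.
  rewrite (psi0 _ (chart_mem c Uv)) mul0r expr0n addr0 => /eqP.
  by rewrite dot_eq0 => /eqP.
have := chart_row_free c Uu; suff -> : jac X u = 0 by rewrite /row_free mxrank0.
apply/row_matrixP => i; rewrite rowK row0 /partial.
have d0 : is_derive u (delta_mx ord0 i) X 0.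
  apply: (@near_eq_is_derive _ _ _ (cst 0)).
  by apply: filterS (chart_nbhs c Uu) => v Uv; rewrite X0.
exact: derive_val.
Qed.

Lemma support_max : exists p, [/\ S p, psi p != 0 &
  forall q, S q -> psi q ^+ 2 <= psi p ^+ 2].
Proof.
have [p Sp pmax] : exists2 p, S p & forall q, S q -> psi q ^+ 2 <= psi p ^+ 2.
  apply: (exists_max (f := fun q => psi q ^+ 2)) => p Sp.
  exact: (cvgM (support_cvg Sp) (support_cvg Sp)).
exists p; split=> //; have [q Sq q0] := support_neq0.
by rewrite -sqrf_eq0 gt_eqF// (lt_le_trans _ (pmax _ Sq))// exprn_even_gt0.
Qed.

(** At a maximum of [psi ^+ 2] the derivative [2 * psi * dot p ('D_s N)] vanishes
in all directions, so the position has no tangential part. *)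
Lemma max_position p : S p -> psi p != 0 ->
  (forall q, S q -> psi q ^+ 2 <= psi p ^+ 2) -> p = psi p *: N p.
Proof.
move=> Sp p0 pmax; have gauss := rt_gauss rt.
have [U [X [u [c Uu Xu]]]] := rt_chart rt Sp.
have [K0 _] := rt_identity rt c Uu.
have [s [_ _ parseval]] := orthonormal_directions gauss c Uu K0.
have orth i : dot p ('D_(s i) (N \o X) u) = 0.
  pose n := N \o X.
  have dsupp v : U v ->
      is_derive v (s i) (fun x => dot (X x) (n x)) (dot (X v) ('D_(s i) n v)).
    by move=> Uv; exact: (support_derive gauss c).
  have dX : is_derive u (s i) X ('D_(s i) X u).
    by apply: is_derive_diff; exact: (chart_diff c).
  have := second_derivative_test (chart_open c) Uu
    (fun v Uv => is_derive_powS 1 (dsupp v Uv))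
    (is_derive_mul (is_derive_mulc 2 (is_derive_powS 0 (dsupp u Uu)))
       (is_derive_dot dX (derive2_normal gauss c (s i) Uu))).
  case.
    by move=> v Uv; have := pmax _ (chart_mem c Uv); rewrite -Xu.
  move=> /eqP + _; rewrite -[dot (X u) (n u)]/(psi (X u)) Xu expr1 !mulf_eq0.
  by rewrite (negbTE p0) pnatr_eq0 /= => /eqP.
have pp : dot p p = psi p ^+ 2.
  by rewrite parseval big1 ?addr0 => [|i _]; rewrite /= ?orth ?mul0r// Xu expr2.
apply/eqP; rewrite -subr_eq0 -dot_eq0.
rewrite !(dotBl, dotBr, dotZl, dotZr) rt_normal_unit// (dotC (N p)) pp.
by rewrite -/(psi p); apply/eqP; ring.
Qed.

Lemma exists_small_power (x y : R) : 0 <= x -> x < 1 -> 0 < y ->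
  exists n, x ^+ n.+1 < y.
Proof.
move=> x0 x1 y0; have : `|x| < 1 by rewrite ger0_norm.
move=> /cvg_expr /cvgr_lt /(_ _ y0) [n _ nP]; exists n.
by apply: nP => /=.
Qed.

(** The function
[psi ^+ 2 / m2 + t], with [m2] the maximum of [psi ^+ 2], is at most [2], with
equality exactly at the points sought.  If its maximum were [2 - 2 * eta] with
[eta > 0], then [psi ^+ 2 <= (1 - eta) * m2] wherever [t >= 1 - eta].  Now choose
[b] so close to [1] that a maximum of [psi ^+ 2n / (b - t)] must by [touching_le0]
lie in that cap, and [n] so large that the values in the cap are too small. *)
Lemma maxima_onto a : dot a a = 1 -> exists p,
  [/\ S p, (forall q, S q -> psi q ^+ 2 <= psi p ^+ 2) & N p = a].
Proof.
move=> a1; have [p0 [Sp0 psi0 p0max]] := support_max.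
pose t q := dot (N q) a; pose m2 := psi p0 ^+ 2.
have m20 : 0 < m2 by rewrite exprn_even_gt0.
have t_le q : S q -> t q <= 1 by move=> Sq; apply: dot_unit_le1 => //; exact: rt_normal_unit.
have t_ge q : S q -> -1 <= t q.
  move=> Sq; have : dot (N q) (- a) <= 1.
    apply: dot_unit_le1; first exact: rt_normal_unit.
    by rewrite dotNl dotNr opprK.
  by rewrite dotNr -/(t q) lerNl.
have tc q : S q -> t x @[x --> within S (nbhs q)] --> t q.
  move=> Sq; apply: (@cvg_dot R _ (within S (nbhs q)) _); last exact: cvg_cst.
  exact: rt_normal_cvg.
have le1 q : S q -> psi q ^+ 2 / m2 <= 1.
  by move=> Sq; rewrite ler_pdivrMr// mul1r; exact: p0max.
have [p Sp pmax] : exists2 p, S p & forall q, S q ->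
    psi q ^+ 2 / m2 + t q <= psi p ^+ 2 / m2 + t p.
  apply: (exists_max (f := fun q => psi q ^+ 2 / m2 + t q)) => q Sq.
  apply: cvgD; last exact: tc.
  apply: cvgMr_tmp; have c := support_cvg Sq; exact: (cvgM c c).
have [ge2|lt2] := lerP 2 (psi p ^+ 2 / m2 + t p).
  have := le1 _ Sp; have := t_le _ Sp => tp1 psip1.
  exists p; split=> //.
    move=> q Sq; apply: le_trans (p0max _ Sq) _.
    have : 1 <= psi p ^+ 2 / m2 by lra.
    by rewrite ler_pdivlMr// mul1r.
  apply: dot_unit_eq => //; first exact: rt_normal_unit.
  by rewrite -/(t p); lra.
exfalso.
pose eta := (2 - (psi p ^+ 2 / m2 + t p)) / 2.
have eta0 : 0 < eta by rewrite /eta; lra.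
have le_eta q : S q -> psi q ^+ 2 / m2 + t q <= 2 - 2 * eta.
  by move=> Sq; have := pmax _ Sq; rewrite /eta; lra.
have eta1 : eta <= 1.
  have := le_eta _ Sp0; rewrite divff ?gt_eqF//; have := t_ge _ Sp0; lra.
clearbody eta; move: {p Sp pmax lt2} eta eta0 le_eta eta1 => eta eta0 le_eta eta1.
(* With this [b], if [t <= 1 - eta] then
   [1 - 2 * b * t + t ^+ 2 >= eta ^+ 2 - eta ^+ 2 / 2 > 0]. *)
pose b := 1 + eta ^+ 2 / 4.
have b1 : 1 < b by rewrite /b; have := exprn_gt0 2 eta0; lra.
have b10 : 0 < b + 1 by lra.
have bt q : S q -> 0 < b - t q by move=> Sq; have := t_le _ Sq; lra.
have [n nP] : exists n, (1 - eta) ^+ n.+1 < (b - 1) / (b + 1).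
  apply: exists_small_power; rewrite ?divr_gt0 ?subr_gt0 ?subr_ge0 ?gtrBl//.
have psiX q : psi q ^+ (2 * n).+2 = (psi q ^+ 2) ^+ n.+1.
  by rewrite -exprM mulnS.
have [p Sp pmax] : exists2 p, S p & forall q, S q ->
    psi q ^+ (2 * n).+2 / (b - t q) <= psi p ^+ (2 * n).+2 / (b - t p).
  apply: (exists_max (f := fun q => psi q ^+ (2 * n).+2 / (b - t q))) => q Sq.
  apply: cvgM.
    have c := support_cvg Sq.
    exact: (cvg_comp _ _ c (@exprn_continuous R (2 * n).+2 (psi q))).
  apply: cvgV; first by rewrite gt_eqF// bt.
  by apply: cvgB; [exact: cvg_cst|exact: tc].
set M := _ / _ in pmax.
have M_ge : m2 ^+ n.+1 / (b + 1) <= M.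
  apply: le_trans (pmax _ Sp0); rewrite psiX -/m2.
  apply: ler_wpM2l; first by apply: exprn_ge0; exact: ltW.
  rewrite lef_pV2 ?posrE ?bt//.
  by have := t_ge _ Sp0; lra.
have M0 : 0 < M.
  by apply: lt_le_trans M_ge; apply: divr_gt0 => //; exact: exprn_gt0.
have Mp : psi p ^+ (2 * n).+2 = M * (b - t p) by rewrite divfK// gt_eqF// bt.
have := @touching_le0 _ S N rt (2 * n) M b a p a1 M0 Sp.
rewrite -/(t p) -subr_gt0 => /(_ (bt _ Sp)) H.
have {}H : 1 - 2 * b * t p + t p ^+ 2 <= 0.
  apply: H => // q Sq; have := pmax _ Sq; rewrite ler_pdivrMr// bt//.
have tp : 1 - eta < t p.
  rewrite ltNge; apply/negP => tp.
  have h0 : eta <= 1 - t p by rewrite lerBrDr -lerBrDl.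
  have h1 : eta ^+ 2 <= (1 - t p) ^+ 2.
    have eta0' := ltW eta0.
    by apply: lerXn2r => //; rewrite nnegrE; exact: le_trans h0.
  have h2 : eta ^+ 2 * t p <= eta ^+ 2 by rewrite ler_piMr ?sqr_ge0// t_le.
  have h3 := exprn_gt0 2 eta0.
  have : 1 - 2 * b * t p + t p ^+ 2 = (1 - t p) ^+ 2 - eta ^+ 2 * t p / 2.
    by rewrite /b; field.
  lra.
have psip : psi p ^+ 2 <= (1 - eta) * m2.
  by rewrite -ler_pdivrMr//; have := le_eta _ Sp; lra.
have : psi p ^+ (2 * n).+2 <= (1 - eta) ^+ n.+1 * m2 ^+ n.+1.
  rewrite psiX -exprMn; apply: lerXn2r => //; rewrite ?nnegrE ?sqr_ge0//.
  by apply: mulr_ge0; [lra|exact: ltW].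
have : m2 ^+ n.+1 / (b + 1) * (b - 1) <= M * (b - t p).
  apply: ler_pM => //; first by apply: divr_ge0; [apply: exprn_ge0|]; exact: ltW.
    by rewrite subr_ge0 ltW.
  by have := t_le _ Sp; lra.
have : (1 - eta) ^+ n.+1 * m2 ^+ n.+1 < (b - 1) / (b + 1) * m2 ^+ n.+1.
  by rewrite ltr_pM2r//; exact: exprn_gt0.
have -> : (b - 1) / (b + 1) * m2 ^+ n.+1 = m2 ^+ n.+1 / (b + 1) * (b - 1).
  by rewrite mulrC mulrA mulrAC.
rewrite Mp => h1 h2 h3; have := lt_le_trans h1 (le_trans h2 h3).
by rewrite ltxx.
Qed.

Definition max_set := [set p | S p /\ forall q, S q -> psi q ^+ 2 <= psi p ^+ 2].

Lemma max_set_support p q : max_set p -> max_set q ->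
  psi p ^+ 2 = psi q ^+ 2.
Proof.
by move=> [Sp pmax] [Sq qmax]; apply/eqP; rewrite eq_le pmax// qmax.
Qed.

Lemma max_set_support_neq0 p : max_set p -> psi p != 0.
Proof.
move=> pA; have [p1 [Sp1 p10 p1max]] := support_max.
by rewrite -sqrf_eq0 (max_set_support pA (conj Sp1 p1max)) sqrf_eq0.
Qed.

(** For [q = m *: a], the maxima with normal [a] and with normal [- a] are each
[q] or [- q]; they are distinct since their normals are, so one of them is [q]. *)
Lemma sphere_sub_max p0 : max_set p0 -> sphere 0 (psi p0) `<=` max_set.
Proof.
move=> p0A q; rewrite /sphere /= subr0 => qq.
have psi0 := max_set_support_neq0 p0A.
set m := psi p0 in qq psi0 *.
have maxP p : max_set p -> p = psi p *: N p /\ (psi p = m \/ psi p = - m).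
  move=> pA; have [Sp pmax] := pA.
  split; first exact: max_position (max_set_support_neq0 pA) pmax.
  have /eqP := max_set_support pA p0A.
  by rewrite eqf_sqr => /orP[] /eqP ->; [left|right].
pose a := m^-1 *: q.
have a1 : dot a a = 1 by rewrite dotZl dotZr qq; field.
have qE : q = m *: a by rewrite scalerA divff// scale1r.
have [p [Sp pmax Np]] := maxima_onto a1.
have [pE] := maxP p (conj Sp pmax).
rewrite Np in pE; case=> psip; rewrite psip in pE; first by rewrite qE -pE; split.
have na1 : dot (- a) (- a) = 1 by rewrite dotNl dotNr opprK.
have [p' [Sp' pmax' Np']] := maxima_onto na1.
have [pE'] := maxP p' (conj Sp' pmax').
rewrite Np' in pE'; case=> psip'; rewrite psip' in pE'; last first.
  by have -> : q = p' by [rewrite qE pE' scalerN scaleNr opprK]; split.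
exfalso.
have pp' : p = p' by rewrite pE pE' scalerN scaleNr.
move: a1; rewrite -pp' Np in Np'.
have : dot a a = dot (- a) a by rewrite -Np'.
rewrite dotNl; lra.
Qed.

Lemma normal_locally_injective p : S p ->
  exists G : set 'rV[R]_3, (\forall q \near within S (nbhs p), G q) /\
    forall q q', G q -> G q' -> N q = N q' -> q = q'.
Proof.
move=> /(rt_chart rt) [U [X [u [c Uu <-]]]]; have gauss := rt_gauss rt.
have [K0 _] := rt_identity rt c Uu.
have [r r0 inj] := locally_injective (chart_open c) Uu
  (fun v => @normal_diff _ S N U X gauss c v)
  (fun i => differentiable_continuous (partial_normal_diff gauss c i Uu))
  (normal_row_free gauss c Uu K0).
have [Y [Yu XY]] := chart_inverse c Uu.
exists [set q | ball u r (Y q) /\ X (Y q) = q]; split; last first.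
  move=> q q' [bq qE] [bq' qE'] Nq; rewrite -qE -qE'; congr (X _).
  by apply: inj => //=; rewrite qE qE'.
apply: filterS2 XY (Yu _ (nbhsx_ballx u r r0)) => q [_ qE] bq.
by split.
Qed.

(** Near a maximum [p] compare [q] in the surface with [phi q = m *: N q].  The
latter is on the sphere, hence again a maximum, and it has the same normal as
[q]; local injectivity of the Gauss map gives [q = phi q]. *)
Lemma max_set_open p : max_set p -> \forall q \near p, S q -> max_set q.
Proof.
move=> pA; have [Sp pmax] := pA.
have m0 := max_set_support_neq0 pA; set m := psi p in m0.
have pE : p = m *: N p by exact: max_position.
have [G [nG inj]] := normal_locally_injective Sp.
pose phi q := m *: N q.
have phiA q : S q -> max_set (phi q).
  move=> Sq; apply: (sphere_sub_max pA).
  rewrite /sphere /= subr0 dotZl dotZr (rt_normal_unit Sq) -/m; ring.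
have nS : \forall q \near within S (nbhs p), S q by exact: withinT.
have phic : phi q @[q --> within S (nbhs p)] --> within S (nbhs p).
  have : phi q @[q --> within S (nbhs p)] --> p.
    by rewrite [X in _ --> X]pE; apply: cvgZl_tmp; exact: rt_normal_cvg.
  move=> h B hB; apply: filterS2 nS (h _ hB) => q Sq; apply.
  by case: (phiA q Sq).
(* Continuity of [psi] excludes the value [- m] at [phi q]. *)
have sgn : \forall q \near within S (nbhs p), 0 < m * psi q.
  have : m * psi q @[q --> within S (nbhs p)] --> m * m.
    by apply: cvgMl_tmp; exact: support_cvg.
  by move/cvgr_gt => /(_ 0); apply; rewrite -expr2 exprn_even_gt0.
suff : \forall q \near within S (nbhs p), max_set q by [].
near=> q.
have Sq : S q by near: q.
have := phiA _ Sq => phiqA; have [Sphi phimax] := phiqA.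
have phiE := max_position Sphi (max_set_support_neq0 phiqA) phimax.
have psiphi : psi (phi q) = m.
  have /eqP := max_set_support phiqA pA; rewrite eqf_sqr => /orP[/eqP//|/eqP e].
  have : 0 < m * psi (phi q) by near: q; exact: phic sgn.
  by rewrite e mulrN oppr_gt0 -expr2 ltNge sqr_ge0.
have Nphi : N q = N (phi q).
  by apply: (scalerI m0); rewrite -[LHS]/(phi q) {1}phiE psiphi.
suff -> : q = phi q by [].
apply: inj => //; near: q => //; exact: phic nG.
Unshelve. all: by end_near. Qed.

Lemma max_set_closed p : S p -> ~ max_set p ->
  \forall q \near p, S q -> ~ max_set q.
Proof.
move=> Sp npA; have [p1 [Sp1 p10 p1max]] := support_max.
have lt_p : psi p ^+ 2 < psi p1 ^+ 2.
  rewrite ltNge; apply/negP => le_p; apply: npA; split=> // q Sq.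
  exact: le_trans (p1max _ Sq) le_p.
have c := support_cvg Sp.
suff : \forall q \near within S (nbhs p), ~ max_set q by [].
have /cvgr_lt /(_ _ lt_p) : psi q ^+ 2 @[q --> within S (nbhs p)] --> psi p ^+ 2.
  exact: (cvgM c c).
by apply: filterS => q lt_q [_ /(_ _ Sp1)]; rewrite leNgt lt_q.
Qed.

End Maxima.

Theorem theorem2p7 (R : realType) (S : set 'rV[R]_3) (N : 'rV[R]_3 -> 'rV[R]_3) :
  rt_surface S N -> compact S -> connected S ->
  exists2 r : R, 0 < r & S = sphere 0 r.
Proof.
move=> rt compactS connectedS.
have [p0 [Sp0 psi0 p0max]] := support_max rt compactS.
have p0A : max_set S N p0 by split.
have AS : max_set S N = S.
  apply: connectedS; first by exists p0.
  - exists (interior [set q | S q -> max_set S N q]); first exact: open_interior.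
    apply/seteqP; split=> [q qA|q [Sq /interior_subset]]; last by apply.
    by split; [case: qA|exact: (max_set_open rt compactS)].
  - exists (~` interior [set q | S q -> ~ max_set S N q]).
      by apply: open_closedC; exact: open_interior.
    apply/seteqP; split=> [q qA|q [Sq nq]].
      by have [Sq _] := qA; split=> // /interior_subset /(_ Sq).
    by apply: contrapT => nqA; apply: nq; exact: (max_set_closed rt compactS).
exists `|support_function N p0|; first by rewrite normr_gt0.
have -> : sphere 0 `|support_function N p0| = sphere 0 (support_function N p0).
  by apply/seteqP; split=> q; rewrite /sphere /= real_normK ?num_real.
apply/seteqP; split=> [q|q /(sphere_sub_max rt compactS p0A) []//].
rewrite -{1}AS => qA; have [Sq qmax] := qA.
have qE := max_position rt Sq (max_set_support_neq0 rt compactS qA) qmax.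
rewrite /sphere /= subr0 -(max_set_support qA p0A) {1 2}qE dotZl dotZr.
by rewrite (rt_normal_unit rt Sq) mulr1 expr2.
Qed.
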